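(* For any two graphs $G$ and $H$, $f_{\text{opt}}(G\times H) \leq f_{\text{opt}}(G)\,f_{\text{opt}}(H)$.
   Context: Graphs are finite and connected. $G\times H$ denotes the Cartesian product: vertex set $V(G)\times V(H)$, with $(g_1,h_1)$ adjacent to $(g_2,h_2)$ iff either $g_1=g_2$ and $h_1h_2\in E(H)$, or $h_1=h_2$ and $g_1g_2\in E(G)$. A distribution of pebbles on a graph assigns a nonnegative integer number of pebbles to each vertex. A pebbling move removes two pebbles from a vertex and places one pebble on an adjacent vertex. A distribution is solvable if for every vertex $v$ there is a sequence (possibly empty) of pebbling moves after which $v$ has at least one pebble. The optimal pebbling number $f_{\text{opt}}(G)$ is the least number of pebbles in a solvable distribution on $G$. *)

(* Defs.v *)
From Stdlib Require Import Relations.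
From mathcomp Require Import all_boot boolp.

Set Implicit Arguments.
Unset Strict Implicit.
Unset Printing Implicit Defensive.

Record sgraph := SGraph {
  vertex :> finType;
  adj : rel vertex;
  adj_sym : symmetric adj;
  adj_irr : irreflexive adj }.

Definition connected (G : sgraph) : Prop :=
  forall x y : G, connect (@adj G) x y.

Section CartesianProduct.

Variables G H : sgraph.

Definition cart_adj : rel (G * H) := fun p q =>
  ((p.1 == q.1) && adj p.2 q.2) || ((p.2 == q.2) && adj p.1 q.1).

Lemma cart_adj_sym : symmetric cart_adj.
Proof.
move=> p q; rewrite /cart_adj (eq_sym p.1) (eq_sym p.2).
by rewrite (adj_sym p.1) (adj_sym p.2).
Qed.

Lemma cart_adj_irr : irreflexive cart_adj.
Proof. by move=> p; rewrite /cart_adj !adj_irr !andbF. Qed.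

Definition cart_prod : sgraph := SGraph cart_adj_sym cart_adj_irr.

End CartesianProduct.

Section Pebbling.

Variable G : sgraph.

Definition distribution := {ffun G -> nat}.

Definition npebbles (D : distribution) : nat := \sum_(v : G) D v.

(* The subtraction is never truncated, since u holds at least two pebbles. *)
Definition pebbling_move (D D' : distribution) : Prop :=
  exists u v : G, [/\ adj u v, 2 <= D u &
    D' = [ffun w => if w == u then D w - 2
                    else if w == v then D w + 1 else D w]].

Definition reachable : distribution -> distribution -> Prop :=
  clos_refl_trans distribution pebbling_move.

Definition solvable (D : distribution) : Prop :=
  forall v : G, exists2 D', reachable D D' & 1 <= D' v.

Lemma solvable_exists :
  exists n, `[< exists2 D, solvable D & npebbles D = n >].
Proof.
pose D : distribution := [ffun=> 1].
exists (npebbles D); apply/asboolP; exists D => // v.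
by exists D; [apply: rt_refl | rewrite ffunE].
Qed.

Definition fopt : nat := ex_minn solvable_exists.

End Pebbling.

(* Main.v *)
(** Let [DG] and [DH] be optimal distributions, and put [DG g * DH h] pebbles on
    [(g, h)].  To reach [(x, y)], run, inside each copy [G x {h}], [DH h] copies
    of the moves bringing a pebble of [DG] to [x]: this leaves at least [DH h]
    pebbles on each [(x, h)], that is, a copy of [DH] on [{x} x H], from which
    [(x, y)] is reached. *)

Require Import Defs.
From Stdlib Require Import Relations.
From mathcomp Require Import all_boot boolp ssralg.

Set Implicit Arguments.
Unset Strict Implicit.
Unset Printing Implicit Defensive.

Import GRing.Theory.

Section Reachability.

Variable G : sgraph.
Implicit Types (D E F : distribution G) (u v : G).

Definition pebble v : distribution G := [ffun w => (w == v) : nat].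

(* Without the truncated subtraction, a move is an additive relation. *)
Lemma pebbling_moveP D D' :
  pebbling_move D D' <->
  exists u v E, [/\ adj u v, D = (E + pebble u *+ 2)%R & D' = (E + pebble v)%R].
Proof.
(* The nested conditional in [pebbling_move] tests [u] first, so it amounts to adding a pebble at
   [v] only because [u] and [v] differ. *)
have adj_neq u v : adj u v -> u != v.
  by apply: contraTneq => ->; rewrite adj_irr.
split=> [[u [v [uv Du ->]]]|[u [v [E [uv -> ->]]]]]; exists u, v.
  (* The witness [E] is the part of [D] that the move leaves in place. *)
  exists [ffun w => if w == u then D w - 2 else D w]; split=> //.
    apply/ffunP=> w; rewrite mulr2n !ffunE /GRing.add /=.
    by case: eqP => [->|_]; rewrite ?subnK // !addn0.
  apply/ffunP=> w; rewrite !ffunE /GRing.add /=.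
  case: (w =P u) => [->|_]; first by rewrite (negPf (adj_neq _ _ uv)) addn0.
  by case: eqP => _; rewrite ?addn0.
split=> //; first by rewrite mulr2n !ffunE eqxx /GRing.add /= leq_addl.
apply/ffunP=> w; rewrite mulr2n !ffunE /GRing.add /=.
case: (w =P u) => [->|_]; first by rewrite (negPf (adj_neq _ _ uv)) addn0 addnK.
by case: eqP => _; rewrite !addn0.
Qed.

(** Extra pebbles never block a move: they join the part [F] that it leaves in place. *)
Lemma reachable_addr D D' E : reachable D D' -> reachable (D + E)%R (D' + E)%R.
Proof.
elim=> [{}D {}D' /pebbling_moveP[u [v [F [uv -> ->]]]]|{}D|D1 D2 D3 _ IH1 _ IH2].
- apply/rt_step/pebbling_moveP; exists u, v, (F + E)%R.
  by split=> //; rewrite addrAC.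
- exact: rt_refl.
- exact: rt_trans IH1 IH2.
Qed.

(** Run the first sequence while [E] lies idle, then the second while [D'] lies idle. *)
Lemma reachableD D D' E E' :
  reachable D D' -> reachable E E' -> reachable (D + E)%R (D' + E')%R.
Proof.
move=> rD rE; apply: rt_trans (reachable_addr E rD) _.
by rewrite ![(D' + _)%R]addrC; apply: reachable_addr.
Qed.

Lemma reachable_sum (I : finType) (D D' : I -> distribution G) :
  (forall i, reachable (D i) (D' i)) ->
  reachable (\sum_i D i)%R (\sum_i D' i)%R.
Proof.
move=> rD; apply: (big_ind2 (fun E F => reachable E F)) => //.
  exact: rt_refl.
by move=> *; apply: reachableD.
Qed.

Lemma reachableMn D D' n : reachable D D' -> reachable (D *+ n)%R (D' *+ n)%R.
Proof.
move=> rD; elim: n => [|n IHn]; first exact: rt_refl.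
by rewrite !mulrS; apply: reachableD.
Qed.

(** Singles out the pebble that has arrived at a target, so that additivity can treat it apart from
    the leftovers. *)
Lemma pebble_split D v : 1 <= D v -> exists E, D = (pebble v + E)%R.
Proof.
move=> Dv; exists [ffun w => D w - (w == v)].
apply/ffunP=> w; rewrite !ffunE /GRing.add /= subnKC //.
by case: eqP => [->|].
Qed.

Lemma npebblesD D E : npebbles (D + E)%R = npebbles D + npebbles E.
Proof.
by rewrite /npebbles -big_split; apply: eq_bigr => v _; rewrite ffunE.
Qed.

Lemma npebbles0 : npebbles (0%R : distribution G) = 0.
Proof. by rewrite /npebbles big1 // => v _; rewrite ffunE. Qed.

Lemma npebbles_sum (I : finType) (D : I -> distribution G) :
  npebbles (\sum_i D i)%R = \sum_i npebbles (D i).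
Proof. exact: (big_morph _ npebblesD npebbles0). Qed.

Lemma npebblesMn D n : npebbles (D *+ n)%R = npebbles D * n.
Proof.
elim: n => [|n IHn]; first by rewrite mulr0n npebbles0 muln0.
by rewrite mulrS npebblesD IHn mulnS.
Qed.

Lemma npebbles_pebble v : npebbles (pebble v) = 1.
Proof.
rewrite /npebbles (bigD1 v) //= ffunE eqxx big1 // => w /negPf wv.
by rewrite ffunE wv.
Qed.

Lemma fopt_attained : exists2 D : distribution G, solvable D & npebbles D = fopt G.
Proof. by rewrite /fopt; case: ex_minnP => n /asboolP. Qed.

Lemma fopt_le D : solvable D -> fopt G <= npebbles D.
Proof.
rewrite /fopt; case: ex_minnP => n _ min_n sD.
by apply: min_n; apply/asboolP; exists D.
Qed.

End Reachability.

Section Pushforward.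

Variables (G K : sgraph) (f : G -> K).
Implicit Types (D E : distribution G).

(** The image distribution: each vertex of [K] collects the pebbles of its fibre under [f]. *)
Definition push D : distribution K := (\sum_v pebble (f v) *+ D v)%R.

Lemma pushD D E : push (D + E)%R = (push D + push E)%R.
Proof.
rewrite /push -big_split; apply: eq_bigr => v _; rewrite ffunE.
exact: mulrnDr.
Qed.

Lemma push0 : push 0%R = 0%R.
Proof. by rewrite /push big1 // => v _; rewrite ffunE. Qed.

Lemma pushMn D n : push (D *+ n)%R = (push D *+ n)%R.
Proof.
elim: n => [|n IHn]; first by rewrite !mulr0n push0.
by rewrite !mulrS pushD IHn.
Qed.

Lemma push_pebble v : push (pebble v) = pebble (f v).
Proof.
rewrite /push (bigD1 v) //= ffunE eqxx big1 ?addr0 // => w /negPf wv.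
by rewrite ffunE wv.
Qed.

Lemma npebbles_push D : npebbles (push D) = npebbles D.
Proof.
rewrite npebbles_sum; apply: eq_bigr => v _.
by rewrite npebblesMn npebbles_pebble mul1n.
Qed.

(** By additivity of [push], a move from [u] to [v] maps to a move from [f u] to [f v], which are
    adjacent since [f] preserves edges. *)
Lemma reachable_push D D' :
  {homo f : u v / adj u v} ->
  reachable D D' -> reachable (push D) (push D').
Proof.
move=> f_adj.
elim=> [{}D {}D' /pebbling_moveP[u [v [E [uv -> ->]]]]|{}D|D1 D2 D3 _ IH1 _ IH2].
- apply/rt_step/pebbling_moveP; exists (f u), (f v), (push E).
  by split; [exact: f_adj | rewrite pushD pushMn push_pebble
            | rewrite pushD push_pebble].
- exact: rt_refl.
- exact: rt_trans IH1 IH2.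
Qed.

End Pushforward.

Section ProductDistribution.

Variables G H : sgraph.

Definition slice1 (h : H) (g : G) : cart_prod G H := (g, h).
Definition slice2 (g : G) (h : H) : cart_prod G H := (g, h).

Lemma slice1_adj h : {homo slice1 h : u v / adj u v}.
Proof. by move=> u v uv; rewrite /= /cart_adj /= eqxx uv orbT. Qed.

Lemma slice2_adj g : {homo slice2 g : u v / adj u v}.
Proof. by move=> u v uv; rewrite /= /cart_adj /= eqxx uv. Qed.

(* This puts [DG g * DH h] pebbles on [(g, h)]. *)
Definition prod_dist (DG : distribution G) (DH : distribution H) :
    distribution (cart_prod G H) :=
  (\sum_h push (slice1 h) (DG *+ DH h))%R.

Lemma npebbles_prod_dist DG DH :
  npebbles (prod_dist DG DH) = npebbles DG * npebbles DH.
Proof.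
rewrite npebbles_sum [in RHS]/npebbles big_distrr; apply: eq_bigr => h _.
by rewrite npebbles_push npebblesMn.
Qed.

(** This links the two stages: the pebble at [x] contributes [DH h] pebbles at each [(x, h)], and
    over all [h] these form a copy of [DH] on [{x} x H]. *)
Lemma prod_dist_pebble x DH E :
  prod_dist (pebble x + E)%R DH = (push (slice2 x) DH + prod_dist E DH)%R.
Proof.
rewrite /prod_dist [push (slice2 x) DH]/push -big_split; apply: eq_bigr => h _ /=.
by rewrite mulrnDl pushD !pushMn push_pebble.
Qed.

Lemma solvable_prod_dist DG DH :
  solvable DG -> solvable DH -> solvable (prod_dist DG DH).
Proof.
move=> sG sH [x y]; have [DG' rG /pebble_split[E defDG']] := sG x.
have [DH' rH /pebble_split[F defDH']] := sH y.
(* The leftovers [E] of the first stage stay idle during the second. *)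
exists (push (slice2 x) DH' + prod_dist E DH)%R; last first.
  by rewrite defDH' pushD push_pebble !ffunE eqxx.
(* First stage: all copies [G x {h}] are played independently, ending at [prod_dist DG' DH]. *)
apply: (@rt_trans _ _ _ (prod_dist DG' DH)).
  apply: reachable_sum => h; apply: (reachable_push (@slice1_adj h)).
  exact: reachableMn.
(* Second stage: only the copy of [DH] on [{x} x H] moves. *)
rewrite defDG' prod_dist_pebble; apply: reachable_addr.
exact: (reachable_push (@slice2_adj x)).
Qed.

End ProductDistribution.

Theorem theorem3 (G H : sgraph) (connG : connected G) (connH : connected H) :
  fopt (cart_prod G H) <= fopt G * fopt H.
Proof.
have [DG sG <-] := fopt_attained G; have [DH sH <-] := fopt_attained H.
by rewrite -npebbles_prod_dist; apply/fopt_le/solvable_prod_dist.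
Qed.
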